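(* Let $M\in\mathbb{N}$, $M\ge1$, and $\rho\in(0,\infty)$. Then, with $\mathrm{Vol}^{\mathbb{R}^M}$ denoting $M$-dimensional Lebesgue measure, $$\mathrm{Vol}^{\mathbb{R}^M}\left(-\left(B^{\rho}\right)^{\sharp}\cap[-1,1]^M\right)\ \ge\ \left[1+\left(\frac{1-1/M}{4\rho+1/M}\right)\right]^M\qquad\text{if }\rho\ge1,$$ $$\mathrm{Vol}^{\mathbb{R}^M}\left(-\left(B^{\rho}\right)^{\sharp}\cap[-1,1]^M\right)\ \ge\ 2^{M-1}\left[1-\frac{\rho}{2(1-\rho)}\right]\qquad\text{if }\rho<1.$$
   Context: For $\rho\in(0,\infty)$ and $M\ge1$, $$B^{\rho}=B^{\rho,M}=\{\beta=(\beta_1,\ldots,\beta_M)\in[0,\infty)^M:\ \beta_1\le\rho\beta_2\le\rho^2\beta_3\le\cdots\le\rho^{M-1}\beta_M\}.$$ For a convex cone $C\subset\mathbb{R}^M$, the polar cone is $C^{\sharp}=\{x\in\mathbb{R}^M: x\cdot c\le 0\ \ \forall c\in C\}$, where $x\cdot c$ is the standard inner product, and $-C^{\sharp}=\{-x:x\in C^\sharp\}$. *)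

(* Defs.v *)
(* Points of R^n are n-tuples, which carry the library's
   product sigma-algebra; coordinates are numbered from 0. *)
From HB Require Import structures.
From mathcomp Require Import all_boot all_order all_algebra.
From mathcomp Require Import all_classical all_reals all_analysis.

Set Implicit Arguments.
Unset Strict Implicit.
Unset Printing Implicit Defensive.

Import Order.TTheory GRing.Theory Num.Theory.
Import numFieldNormedType.Exports.

Local Open Scope classical_set_scope.
Local Open Scope ring_scope.

Section ConsMeasure.
Context {R : realType} (n : nat).

Definition cons_pair (p : R * n.-tuple R) : n.+1.-tuple R :=
  [tuple of p.1 :: p.2].

Definition split_tuple (t : n.+1.-tuple R) : R * n.-tuple R :=
  (thead t, [tuple of behead t]).

Lemma cons_pairK : cancel cons_pair split_tuple.
Proof. by case=> x t; congr pair; apply: val_inj. Qed.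

Lemma measurable_cons_pair : measurable_fun setT cons_pair.
Proof. exact: measurable_cons. Qed.

Lemma measurable_split_tuple : measurable_fun setT split_tuple.
Proof.
apply: measurable_fun_pair; first exact: measurable_tnth.
exact: measurable_behead.
Qed.

Variable mu : {sigma_finite_measure set (n.-tuple R) -> \bar R}.

(* The product of the Lebesgue measure on R and mu, transported along the
   identification of R * R^n with R^(n+1). *)
Definition cons_measure : set (n.+1.-tuple R) -> \bar R :=
  pushforward (lebesgue_measure \x mu)%E cons_pair.

Let cons_measure0 : cons_measure set0 = 0%E.
Proof. by rewrite /cons_measure /pushforward preimage_set0 measure0. Qed.

Let cons_measure_ge0 A : (0 <= cons_measure A)%E.
Proof. by apply: integral_ge0 => x _; exact: measure_ge0. Qed.

Let cons_measure_sigma_additive : semi_sigma_additive cons_measure.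
Proof.
apply: measure_semi_sigma_additive.
exact: measurable_cons_pair.
Qed.

HB.instance Definition _ := isMeasure.Build _ _ _ cons_measure
  cons_measure0 cons_measure_ge0 cons_measure_sigma_additive.

Let cons_measure_sigma_finite : sigma_finite setT cons_measure.
Proof.
have /sigma_finiteP[F [TF ndF Foo]] := sigma_finiteT (@lebesgue_measure R).
have /sigma_finiteP[G [TG ndG Goo]] := sigma_finiteT mu.
exists (fun k => split_tuple @^-1` (F k `*` G k)).
  apply/seteqP; split=> // t _.
  have [i _ Fi] : (\bigcup_i F i) (split_tuple t).1 by rewrite -TF.
  have [j _ Gj] : (\bigcup_i G i) (split_tuple t).2 by rewrite -TG.
  exists (maxn i j) => //; split.
  - by move: Fi; apply/subsetPset/ndF/leq_maxl.
  - by move: Gj; apply/subsetPset/ndG/leq_maxr.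
move=> k; have [mF Fk] := Foo k; have [mG Gk] := Goo k; split.
  rewrite -[X in measurable X]setTI.
  by apply: measurable_split_tuple => //; exact: measurableX.
rewrite /cons_measure /pushforward (_ : _ @^-1` _ = F k `*` G k).
  by rewrite product_measure1E// lte_mul_pinfty// ge0_fin_numE.
by apply/seteqP; split=> p; rewrite /preimage /mkset cons_pairK.
Qed.

HB.instance Definition _ := Measure_isSigmaFinite.Build _ _ _ cons_measure
  cons_measure_sigma_finite.
End ConsMeasure.

Section Volume.
Context {R : realType}.

(* n-dimensional Lebesgue measure, as the iterated product of the
   one-dimensional one; it is determined by its values on boxes, given by
   [volume_box]. *)
Fixpoint volume n : {sigma_finite_measure set (n.-tuple R) -> \bar R} :=
  match n with
  | 0 => \d_([tuple] : 0.-tuple R)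
  | n'.+1 => cons_measure (volume n')
  end.

Lemma volume_box n (F : 'I_n -> set R) : (forall i, measurable (F i)) ->
  volume n [set t | forall i, F i (tnth t i)] =
  (\prod_(i < n) lebesgue_measure (F i))%E.
Proof.
elim: n F => [|n IHn] F mF.
  by rewrite big_ord0 /= diracE mem_set// => -[].
rewrite big_ord_recl /= -IHn//.
rewrite /cons_measure /pushforward -product_measure1E//; last first.
- rewrite (_ : [set t | _] = \big[setI/setT]_(i < n)
     ((fun t : n.-tuple R => tnth t i) @^-1` F (lift ord0 i))).
    apply: bigsetI_measurable => i _.
    rewrite -[X in measurable X]setTI; exact: measurable_tnth.
  rewrite -bigcap_seq; apply/seteqP; split=> t /= Ft i; first by move=> _; exact: Ft.
  by apply: Ft => /=; rewrite mem_index_enum.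
- exact: mF.
congr (product_measure1 _ _ _).
apply/seteqP; split=> [[x t]|[x t] [/= Fx Ft] i] /=.
  move=> Fxt; split=> [|i] /=; first exact: (Fxt ord0).
  by have := Fxt (lift ord0 i); rewrite tnthS.
by case: (unliftP ord0 i) => [j|] ->//; rewrite tnthS; exact: Ft.
Qed.

End Volume.

Section Cones.
Context {R : realType} {M : nat}.
Implicit Types x c b : M.-tuple R.

Definition dot x c : R := \sum_(i < M) tnth x i * tnth c i.

Definition polar (C : set (M.-tuple R)) : set (M.-tuple R) :=
  [set x | forall c, C c -> dot x c <= 0].

Definition opp_set (A : set (M.-tuple R)) : set (M.-tuple R) :=
  [set map_tuple -%R x | x in A].

Definition cube : set (M.-tuple R) :=
  [set x | forall i, -1 <= tnth x i <= 1].

(* Since the coordinates are numbered from 0, the weight of the i-th one in the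
   chain of inequalities is rho ^+ i. *)
Definition Bcone (rho : R) : set (M.-tuple R) :=
  [set b | (forall i, 0 <= tnth b i) /\
           (forall i j : 'I_M, j = i.+1 :> nat ->
              rho ^+ i * tnth b i <= rho ^+ j * tnth b j)].

End Cones.

Arguments cube {R} M.
Arguments Bcone {R} M rho.

(* Main.v *)
(* The dual cone of B^rho consists of the x whose weighted suffix sums
   s_i = x_i + s_(i+1) / rho are all nonnegative, so the volume measures the
   paths of the walk s, run from the last coordinate to the first with steps in
   [-1, 1], that never become negative.
   If rho >= 1, one step of the walk maps the payoff a + b min(s, 1) to a payoff
   at least a' + b' min(s, 1), where a' = a + b / 2 and b' = (a + b) / rho.
   Iterating from (1, 0) gives the volume at least (1 + 1 / (2 rho))^(M-1).
   If rho < 1, the threshold c that the walk has to reach is pulled back instead: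
   reaching c by a step x follows from having reached rho (c + |x|) before it,
   and |x| has mean 1/2 on [-1, 1]. *)
Require Import Defs.
From mathcomp Require Import all_boot all_order all_algebra.
From mathcomp Require Import all_classical all_reals all_analysis.
From mathcomp Require Import measurable_realfun ring lra.

Import Order.TTheory GRing.Theory Num.Theory.
Import numFieldNormedType.Exports.

Local Open Scope classical_set_scope.
Local Open Scope ring_scope.

(** * Lower bounds for one-dimensional integrals by affine minorants *)

Lemma integral_affine (R : realType) (p q c d : R) : c <= d ->
  (\int[lebesgue_measure]_(x in `[c, d]) (p * x + q)%:E =
   (p / 2 * (d ^+ 2 - c ^+ 2) + q * (d - c))%:E)%E.
Proof.
rewrite le_eqVlt => /predU1P[->|cd].
  by rewrite set_itv1 integral_set1 !subrr !mulr0 addr0.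
pose F x : R := p / 2 * x ^+ 2 + q * x.
have dF (x : R) : is_derive x (1 : R) F (p * x + q).
  by apply: is_derive_eq; rewrite /GRing.scale /=; field.
have cF : continuous F.
  move=> x; apply: differentiable_continuous; apply/derivable1_diffP.
  by case: (dF x).
have cf : continuous (fun x : R => p * x + q).
  move=> x; apply: cvgD; last exact: cvg_cst.
  by apply: cvgM; [exact: cvg_cst | exact: cvg_id].
rewrite (@continuous_FTC2 _ _ F)//.
- by rewrite -EFinB /F; congr _%:E; ring.
- exact: continuous_subspaceT.
- split; first by move=> x _; case: (dF x).
  + by apply/cvg_at_right_filter; exact: cF.
  + by apply/cvg_at_left_filter; exact: cF.
- by move=> x _; rewrite derive1E; apply: derive_val.
Qed.

(** The minorant may take negative values. Dropping its negative part only increases its integral,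
    and its positive part is still below [f] because [f] is nonnegative. *)
Lemma integral_ge_affine (R : realType) (f : R -> \bar R) (D : set R)
    (p q c d : R) :
  measurable D -> measurable_fun D f -> (forall x, D x -> 0 <= f x)%E -> c <= d ->
  `]c, d[ `<=` D ->
  (forall x, x \in `]c, d[ -> (p * x + q)%:E <= f x)%E ->
  ((p / 2 * (d ^+ 2 - c ^+ 2) + q * (d - c))%:E <=
   \int[lebesgue_measure]_(x in D) f x)%E.
Proof.
move=> mD mf f0 cd cdD ge_f.
have maff (E : set R) : measurable_fun E (fun x : R => (p * x + q)%:E).
  by apply/measurable_EFinP/measurable_funTS/measurable_funD.
have mcd : measurable_fun `]c, d[ f by exact: measurable_funS mf.
rewrite -integral_affine// -integral_itv_obnd_cbnd; last exact: maff.
rewrite -integral_itv_bndo_bndc; last exact: maff.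
apply: (@le_trans _ _ (\int[lebesgue_measure]_(x in `]c, d[) f x)%E); last first.
  exact: ge0_subset_integral.
rewrite integralE -[leRHS]sube0; apply: leeB; last by apply: integral_ge0.
apply: ge0_le_integral => //.
  by apply: measurable_funepos; exact: maff.
by move=> x cdx; rewrite funeposE ge_max ge_f//= f0//; exact: cdD.
Qed.

(** Meant for minorants with one kink, at [d]: the cap at 1 when rho >= 1, the absolute value when
    rho < 1. The line is cut at [d] and each half carries one affine piece. *)
Lemma integral_ge_affine2 (R : realType) (f : R -> \bar R)
    (p q p' q' c d e : R) :
  measurable_fun setT f -> (forall x, 0 <= f x)%E -> c <= d -> d <= e ->
  (forall x, x \in `]c, d[ -> (p * x + q)%:E <= f x)%E ->
  (forall x, x \in `]d, e[ -> (p' * x + q')%:E <= f x)%E ->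
  ((p / 2 * (d ^+ 2 - c ^+ 2) + q * (d - c) +
    (p' / 2 * (e ^+ 2 - d ^+ 2) + q' * (e - d)))%:E <=
   \int[lebesgue_measure]_x f x)%E.
Proof.
move=> mf f0 cd de ge1 ge2; rewrite EFinD.
have mD : measurable (`]-oo, d] : set R) by [].
rewrite -(setvU `]-oo, d]) ge0_integral_setU//=; last 3 first.
- exact: measurableC.
- by apply: measurable_funS mf.
- exact/disj_setPCr.
rewrite addeC; apply: leeD.
  apply: integral_ge_affine => //.
  - exact: measurableC.
  - exact: measurable_funS mf.
  - by move=> x; rewrite setCitvl/= !in_itv/= andbT => /andP[].
apply: integral_ge_affine => //; first exact: measurable_funS mf.
by move=> x; rewrite /= !in_itv/= => /andP[_ /ltW].
Qed.

(** * Integration over R^(n+1) by splitting off the first coordinate *)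

Lemma split_tupleK {R : realType} {n : nat} :
  cancel (@split_tuple R n) (@cons_pair R n).
Proof. by move=> t; rewrite [RHS]tuple_eta; apply: val_inj. Qed.

(** Tonelli with the first coordinate innermost: once the tail is fixed, the walk has a single step
    left. *)
Lemma integral_volumeS (R : realType) (n : nat) (f : n.+1.-tuple R -> \bar R) :
  measurable_fun setT f -> (forall t, 0 <= f t)%E ->
  (\int[volume n.+1]_t f t =
   \int[volume n]_t \int[lebesgue_measure]_x f (cons_pair (x, t)))%E.
Proof.
move=> mf f0; pose c : measurableTypeR R * n.-tuple R -> n.+1.-tuple R := @cons_pair R n.
have mc : measurable_fun setT c by exact: measurable_cons_pair.
have mf' : measurable_fun setT (f \o c) by exact: measurableT_comp.
rewrite -(@fubini_tonelli2 _ _ _ _ R lebesgue_measure (volume n) _ mf'); last first.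
  by move=> z; exact: f0.
have f0' : {in setT, forall t, 0 <= f t}%E by move=> t _.
pose mu : measure (measurableTypeR R * n.-tuple R)%type R := (@lebesgue_measure R \x volume n)%E.
have := ge0_integral_pushforward mc mu measurableT mf f0'.
rewrite preimage_setT => <-.
by [].
Qed.

Lemma measurable_integral_section (R : realType) (n : nat)
    (f : n.+1.-tuple R -> \bar R) :
  measurable_fun setT f -> (forall t, 0 <= f t)%E ->
  measurable_fun setT
    (fun t : n.-tuple R => \int[lebesgue_measure]_x f (cons_pair (x, t)))%E.
Proof.
move=> mf f0.
pose c : measurableTypeR R * n.-tuple R -> n.+1.-tuple R := @cons_pair R n.
have mc : measurable_fun setT c by exact: measurable_cons_pair.
have mf' : measurable_fun setT (f \o c) by exact: measurableT_comp.
by apply: (@measurable_fun_fubini_tonelli_G _ _ _ _ R lebesgue_measure _ mf') => z; exact: f0.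
Qed.

(** The opposite order to [integral_volumeS]: the first coordinate is outermost, so that its value
    can determine the threshold imposed on the tail. *)
Lemma volumeS (R : realType) (n : nat) (A : set (n.+1.-tuple R)) :
  (volume n.+1 A =
   \int[lebesgue_measure]_x volume n [set t | A (cons_pair (x, t))])%E.
Proof.
rewrite /= /cons_measure /pushforward /product_measure1.
by apply: eq_integral => x _ /=; rewrite xsectionE.
Qed.

Lemma measurable_volume_section (R : realType) (n : nat)
    (A : set (n.+1.-tuple R)) :
  measurable A ->
  measurable_fun setT (fun x : R => volume n [set t | A (cons_pair (x, t))]).
Proof.
move=> mA.
have mA' : measurable (@cons_pair R n @^-1` A : set (measurableTypeR R * n.-tuple R)).
  by rewrite -[X in measurable X]setTI; exact: measurable_cons_pair.
have := measurable_fun_xsection (volume n) mA'.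
by under [X in measurable_fun _ X -> _]eq_fun do rewrite /= xsectionE.
Qed.

(** * Weighted suffix sums and the dual cone of B^rho *)

Section SuffixSums.
Context {R : realType} (rho : R).

Definition wsum (s : seq R) : R := foldr (fun x r => x + r / rho) 0 s.

Fixpoint wsums_ge0 (s : seq R) : bool :=
  if s is _ :: s' then (0 <= wsum s) && wsums_ge0 s' else true.

Definition in_cube (s : seq R) : bool := all (fun x => -1 <= x <= 1) s.

Lemma in_cube_cons n (x : R) (t : n.-tuple R) :
  in_cube (cons_pair (x, t)) = (-1 <= x <= 1) && in_cube t.
Proof. by []. Qed.

Lemma measurable_wsum n : measurable_fun setT (fun t : n.-tuple R => wsum t).
Proof.
elim: n => [|n IHn].
  rewrite (_ : (fun _ => _) = cst (wsum [::])); first exact: measurable_cst.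
  by apply/funext => t; rewrite (tuple0 t).
rewrite (_ : (fun _ => _) =
    fun t : n.+1.-tuple R => thead t + wsum [tuple of behead t] / rho); last first.
  by apply/funext => t; rewrite {1}(tuple_eta t).
apply: measurable_funD; first exact: measurable_tnth.
apply: measurable_funM => //.
by apply: (measurableT_comp IHn); exact: measurable_behead.
Qed.

Lemma measurable_wsums_ge0 n :
  measurable_fun setT (fun t : n.-tuple R => wsums_ge0 t).
Proof.
elim: n => [|n IHn].
  rewrite (_ : (fun _ => _) = cst (wsums_ge0 [::])); first exact: measurable_cst.
  by apply/funext => t; rewrite (tuple0 t).
rewrite (_ : (fun _ => _) = fun t : n.+1.-tuple R =>
    (0 <= wsum t) && wsums_ge0 [tuple of behead t]); last first.
  by apply/funext => t; rewrite {1 2}(tuple_eta t).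
apply: measurable_and.
  by apply: measurable_fun_ler => //; exact: measurable_wsum.
by apply: (measurableT_comp IHn); exact: measurable_behead.
Qed.

Lemma measurable_in_cube n :
  measurable_fun setT (fun t : n.-tuple R => in_cube t).
Proof.
elim: n => [|n IHn].
  rewrite (_ : (fun _ => _) = cst (in_cube [::])); first exact: measurable_cst.
  by apply/funext => t; rewrite (tuple0 t).
rewrite (_ : (fun _ => _) = fun t : n.+1.-tuple R =>
    (-1 <= thead t) && (thead t <= 1) && in_cube [tuple of behead t]); last first.
  by apply/funext => t; rewrite {1}(tuple_eta t).
apply: measurable_and; last first.
  by apply: (measurableT_comp IHn); exact: measurable_behead.
by apply: measurable_and; apply: measurable_fun_ler => //; exact: measurable_tnth.
Qed.

Lemma in_cubeE M : cube M = [set t : M.-tuple R | in_cube t].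
Proof.
by apply/seteqP; split=> t /=; [move=> tc; exact/all_tnthP | move/all_tnthP].
Qed.

Lemma dot_cons n (x c : R) (t b : n.-tuple R) :
  dot (cons_pair (x, t)) (cons_pair (c, b)) = x * c + dot t b.
Proof.
rewrite /dot big_ord_recl; congr (_ * _ + _).
by apply: eq_bigr => i _; rewrite !tnthS.
Qed.

Lemma wsum_cons n (x : R) (t : n.-tuple R) :
  wsum (cons_pair (x, t)) = x + wsum t / rho.
Proof. by []. Qed.

Lemma wsums_ge0_cons n (x : R) (t : n.-tuple R) :
  wsums_ge0 (cons_pair (x, t)) = (0 <= x + wsum t / rho) && wsums_ge0 t.
Proof. by []. Qed.

Lemma wsumE n (t : n.-tuple R) : wsum t = dot t [tuple rho ^- i | i < n].
Proof.
elim: n t => [|n IHn] t; first by rewrite (tuple0 t) /dot big_ord0.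
rewrite -(split_tupleK t); case: (split_tuple t) => {}x {}t.
rewrite wsum_cons IHn /dot big_ord_recl tnth_mktuple expr0 invr1 mulr1.
congr (_ + _); rewrite mulr_suml; apply: eq_bigr => i _.
rewrite !tnth_mktuple tnthS/= -mulrA; congr (_ * _).
by rewrite /bump/= add1n exprSr invfM mulrC.
Qed.

Context (rho_gt0 : 0 < rho).

(** Dividing the chain for the tail by [rho] gives a chain of the same form, so only the link
    between the first two coordinates remains. Quantifying over indices of value 0 makes that link
    vacuous when the tail is empty. *)
Lemma Bcone_cons n (c : R) (b : n.-tuple R) :
  Bcone n.+1 rho (cons_pair (c, b)) <->
  [/\ 0 <= c, Bcone n rho b &
    forall i : 'I_n, i = 0%N :> nat -> c <= rho * tnth b i].
Proof.
split=> [[b0 bS]|[c0 [b0 bS] cb]].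
  split; first exact: (b0 ord0).
    split=> [i|i j ij]; first by have := b0 (lift ord0 i); rewrite tnthS.
    have := bS (lift ord0 i) (lift ord0 j); rewrite !tnthS /= /bump/= !add1n ij.
    by move=> /(_ erefl); rewrite !exprS -!mulrA !ler_pM2l.
  move=> i i0; have := bS ord0 (lift ord0 i); rewrite tnthS/= /bump/= i0.
  by move=> /(_ erefl); rewrite expr0 mul1r.
split=> [i|i j].
  by case: (unliftP ord0 i) => [k|] ->//; rewrite tnthS.
case: (unliftP ord0 i) => [k|] ->; case: (unliftP ord0 j) => [l|] ->//=;
  rewrite ?tnthS /bump/= ?add1n => -[].
- by move=> kl; rewrite !exprS -!mulrA !ler_pM2l//; apply: bS.
- by move=> l0; rewrite l0 expr0 mul1r; apply: cb.
Qed.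

(* Summation by parts; c stands for the coordinate of b preceding the first one. *)
Lemma dot_ge_wsum n (c : R) (t b : n.-tuple R) : 0 <= c ->
  (forall i : 'I_n, i = 0%N :> nat -> c <= rho * tnth b i) ->
  wsums_ge0 t -> Bcone n rho b -> c * (wsum t / rho) <= dot t b.
Proof.
elim: n c t b => [|n IHn] c t b c0 cb.
  by rewrite (tuple0 t) /dot big_ord0 /= mul0r mulr0.
move: cb; rewrite -(split_tupleK t) -(split_tupleK b).
case: (split_tuple t) (split_tuple b) => {}x {}t [d {}b] cb.
rewrite wsums_ge0_cons wsum_cons dot_cons => /andP[w0 st] /Bcone_cons[d0 Bb db].
have cd : c / rho <= d by rewrite ler_pdivrMr// mulrC; exact: (cb ord0).
apply: (@le_trans _ _ (d * (x + wsum t / rho))).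
  by rewrite mulrCA mulrC ler_wpM2r// mulrC.
by rewrite mulrDr mulrC lerD2l; exact: IHn.
Qed.

Lemma dual_Bcone n (t : n.-tuple R) :
  (forall b, Bcone n rho b -> 0 <= dot t b) <-> wsums_ge0 t.
Proof.
split=> [|st b Bb]; last first.
  rewrite -(mul0r (wsum t / rho)); apply: dot_ge_wsum => // i _.
  by case: Bb => b0 _; rewrite pmulr_rge0.
elim: n t => [|n IHn] t; first by rewrite (tuple0 t).
rewrite -(split_tupleK t); case: (split_tuple t) => {}x {}t tB.
rewrite wsums_ge0_cons -wsum_cons; apply/andP; split.
  (* The test vector has coordinates rho^(-i); it lies in the cone with equality at every link. *)
  rewrite wsumE; apply: tB; split=> [i|i j ij].
    by rewrite tnth_mktuple invr_ge0 exprn_ge0// ltW.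
  by rewrite !tnth_mktuple !mulfV// expf_neq0// gt_eqF.
(* Proper suffixes are tested by vectors with a 0 prepended. *)
apply: IHn => b Bb; have := tB (cons_pair (0, b)); rewrite dot_cons mulr0 add0r; apply.
apply/Bcone_cons; split=> // i _; by case: Bb => b0 _; rewrite pmulr_rge0.
Qed.

Lemma opp_polarE n :
  opp_set (polar (Bcone n rho)) = [set t : n.-tuple R | wsums_ge0 t].
Proof.
have dotN (t b : n.-tuple R) : dot (map_tuple -%R t) b = - dot t b.
  by rewrite /dot -sumrN; apply: eq_bigr => i _; rewrite tnth_map mulNr.
apply/seteqP; split=> [_ [t tB <-]|t /dual_Bcone tB] /=.
  by apply/dual_Bcone => b /tB; rewrite dotN oppr_ge0.
exists (map_tuple -%R t).
  by move=> b /tB; rewrite dotN oppr_le0.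
by apply: eq_from_tnth => i; rewrite !tnth_map opprK.
Qed.

End SuffixSums.

(** * The case rho >= 1: propagation of capped affine payoffs *)

Section LargeRho.
Context {R : realType} (rho : R).
Context (rho_ge1 : 1 <= rho).

Let rho_gt0 : 0 < rho. Proof. exact: lt_le_trans ltr01 rho_ge1. Qed.

(** A step x in ]-u, 1-u[ pays at least a + b (x + u), where x + u runs over the unit interval: this
    contributes a + b / 2. A step in ]1-u, 1[ reaches the cap and pays a + b: this contributes (a +
    b) u. *)
Lemma integral_step (a b s : R) : 0 <= a -> 0 <= b -> 0 <= s ->
  ((a + b / 2 + (a + b) / rho * Num.min s 1)%:E <=
   \int[lebesgue_measure]_x
     (if (-1 <= x <= 1) && (0 <= x + s / rho)
      then a + b * Num.min (x + s / rho) 1 else 0)%:E)%E.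
Proof.
move=> a0 b0 s0; pose u := Num.min s 1 / rho.
have u0 : 0 <= u by rewrite divr_ge0 ?(ltW rho_gt0)// le_min s0 ler01.
(* Here rho >= 1 enters: it keeps ]-u, 1-u[ inside [-1, 1]. *)
have u1 : u <= 1 by rewrite ler_pdivrMr// mul1r ge_min rho_ge1 orbT.
have us : u <= s / rho by rewrite ler_pM2r ?invr_gt0// ge_min lexx.
rewrite (_ : _ + _ = b / 2 * ((1 - u) ^+ 2 - (- u) ^+ 2)
    + (a + b * u) * ((1 - u) - - u)
    + (0 / 2 * (1 ^+ 2 - (1 - u) ^+ 2) + (a + b) * (1 - (1 - u)))); last first.
  by rewrite mulrAC -mulrA -/u; field.
have mx : measurable_fun setT (fun x : R => x + s / rho).
  exact: measurable_funD.
apply: integral_ge_affine2.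
- apply/measurable_EFinP; apply: measurable_fun_ifT.
  + by apply: measurable_and; [apply: measurable_and|]; exact: measurable_fun_ler.
  + apply: measurable_funD => //; apply: measurable_funM => //.
    exact: measurable_minr.
  + exact: measurable_cst.
- move=> x; rewrite lee_fin; case: ifP => // /andP[_ x0].
  by rewrite addr_ge0// mulr_ge0// le_min x0 ler01.
- lra.
- lra.
- move=> x; rewrite in_itv/= lee_fin => /andP[x1 x2].
  rewrite ifT; last by apply/andP; split; [apply/andP; split|]; lra.
  rewrite (_ : b * x + (a + b * u) = a + b * (x + u)); last by ring.
  rewrite lerD2l ler_wpM2l// le_min lerD2l us/=; lra.
- move=> x; rewrite in_itv/= lee_fin => /andP[x1 x2].
  rewrite ifT; last by apply/andP; split; [apply/andP; split|]; lra.
  rewrite mul0r add0r min_r ?mulr1//; lra.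
Qed.

Definition affine_step (p : R * R) : R * R :=
  (p.1 + p.2 / 2, (p.1 + p.2) / rho).

Definition capped_affine (a b : R) (s : seq R) : R :=
  if in_cube s && wsums_ge0 rho s then a + b * Num.min (wsum rho s) 1 else 0.

Lemma measurable_capped_affine n (a b : R) :
  measurable_fun setT (fun t : n.-tuple R => (capped_affine a b t)%:E).
Proof.
apply/measurable_EFinP; apply: measurable_fun_ifT => //.
  by apply: measurable_and; [exact: measurable_in_cube|exact: measurable_wsums_ge0].
apply: measurable_funD => //; apply: measurable_funM => //.
by apply: measurable_minr => //; exact: measurable_wsum.
Qed.

Lemma wsum_ge0 (s : seq R) : wsums_ge0 rho s -> 0 <= wsum rho s.
Proof. by case: s => //= x s /andP[]. Qed.

Lemma capped_affine_ge0 (a b : R) (s : seq R) : 0 <= a -> 0 <= b ->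
  (0 <= (capped_affine a b s)%:E)%E.
Proof.
move=> a0 b0; rewrite lee_fin /capped_affine; case: ifP => // /andP[_ st].
by rewrite addr_ge0// mulr_ge0// le_min wsum_ge0//= ler01.
Qed.

(** Integrating out the first coordinate by [integral_step] leaves a payoff on the tail with
    coefficients [affine_step (a, b)], so the induction runs over all nonnegative [a] and [b]. *)
Lemma integral_capped_affine n (a b : R) : 0 <= a -> 0 <= b ->
  ((iter n affine_step (a, b)).1%:E <=
   \int[volume n]_t (capped_affine a b t)%:E)%E.
Proof.
elim: n a b => [|n IHn] a b a0 b0.
  rewrite /= integral_dirac//; last exact: measurable_capped_affine.
  by rewrite diracE mem_set// mul1e lee_fin /capped_affine/= min_l ?ler01// mulr0 addr0.
have mf := measurable_capped_affine n.+1 a b.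
rewrite iterSr integral_volumeS//; last by move=> t; exact: capped_affine_ge0.
have a0' : 0 <= a + b / 2 by lra.
have b0' : 0 <= (a + b) / rho by rewrite divr_ge0 ?(ltW rho_gt0)//; lra.
apply: (le_trans (IHn _ _ a0' b0')); apply: ge0_le_integral => //.
- by move=> t _; exact: capped_affine_ge0.
- exact: measurable_capped_affine.
- by apply: (measurable_integral_section _ _ _ mf) => t; exact: capped_affine_ge0.
(* A tail that leaves the cube or has a negative suffix sum pays 0, and the bound is trivial
   there. *)
move=> t _; rewrite /capped_affine; case: ifPn => [/andP[ct st]|_]; last first.
  by apply: integral_ge0 => x _; exact: capped_affine_ge0.
apply: (le_trans (integral_step _ _ _ a0 b0 (wsum_ge0 _ st))).
rewrite le_eqVlt; apply/orP; left; apply/eqP; apply: eq_integral => x _.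
by rewrite wsums_ge0_cons wsum_cons in_cube_cons ct st !andbT.
Qed.

(** The second inequality is the invariant behind the first: q >= p / rho turns p + q / 2 into at
    least p (1 + 1 / (2 rho)). The first step, from (1, 0) to (1, 1 / rho), gains nothing, hence
    exponent [n] after [n.+1] steps. *)
Lemma iter_affine_step_ge n :
  (1 + 1 / (2 * rho)) ^+ n <= (iter n.+1 affine_step (1, 0)).1 /\
  (iter n.+1 affine_step (1, 0)).1 / rho <= (iter n.+1 affine_step (1, 0)).2.
Proof.
elim: n => [|n]; first by rewrite /affine_step/= !mul0r !addr0.
rewrite [iter n.+2 _ _]iterS; case: (iter n.+1 _ _) => p q /= [].
set r := 1 + 1 / (2 * rho); have r0 : 0 <= r ^+ n.
  by rewrite exprn_ge0// addr_ge0// divr_ge0// mulr_ge0// ltW.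
move=> rp pq; have q0 : 0 <= q.
  by rewrite (le_trans _ pq)// divr_ge0 ?(ltW rho_gt0)// (le_trans r0).
split; last by rewrite ler_pM2r ?invr_gt0//; lra.
apply: (@le_trans _ _ (p * r)).
  by rewrite exprSr ler_wpM2r// addr_ge0// divr_ge0// mulr_ge0// ltW.
rewrite (_ : p * r = p + p / rho / 2); first lra.
by rewrite /r; field; rewrite gt_eqF.
Qed.

(** From exp(-z) >= 1 - z follows exp z <= 1 / (1 - z), and (1 + 2z)(1 - z) = 1 + z (1 - 2z) >=
    1. *)
Lemma expR_le1D2x (z : R) : 0 <= z -> z <= 1 / 4 -> expR z <= 1 + 2 * z.
Proof.
move=> z0 z1.
have ez : 1 - z <= (expR z)^-1 by rewrite -expRN; exact: expR_ge1Dx.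
rewrite -[expR z]invrK invf_ple ?posrE ?invr_gt0 ?expR_gt0//; last lra.
apply: le_trans ez; rewrite -[leLHS]mul1r ler_pdivrMr; last lra.
by nra.
Qed.

(** Both sides are compared with exponentials. With M = n + 1, i = 1 / M, y = (1 - i) / (4 rho + i)
    and z = 1 / (4 rho), one has 1 + y <= exp y, then M y <= n z because M (1 - i) = n, and finally
    exp z <= 1 + 2z. *)
Lemma large_rho_rate n :
  (1 + (1 - 1 / n.+1%:R) / (4 * rho + 1 / n.+1%:R)) ^+ n.+1 <=
  (1 + 1 / (2 * rho)) ^+ n.
Proof.
have [i [-> i0 i1 iE]] : exists i : R,
    [/\ 1 / n.+1%:R = i, 0 < i, i <= 1 & i * n.+1%:R = 1].
  exists (1 / n.+1%:R); split=> //.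
    by rewrite ler_pdivrMr// mul1r ler1n.
  by rewrite divfK// pnatr_eq0.
have rho4 : 0 < 4 * rho by rewrite mulr_gt0.
have z0 : 0 <= (4 * rho)^-1 by rewrite invr_ge0 ltW.
have z1 : (4 * rho)^-1 <= 1 / 4.
  by rewrite div1r lef_pV2 ?posrE// ler_peMr.
have y0 : 0 <= (1 - i) / (4 * rho + i).
  by rewrite divr_ge0 ?subr_ge0// ltW// addr_gt0.
have yz : (1 - i) / (4 * rho + i) * n.+1%:R <= (4 * rho)^-1 * n%:R.
  rewrite (_ : n%:R = (1 - i) * n.+1%:R); last by rewrite mulrBl iE mul1r -natr1 addrK.
  rewrite mulrA ler_pM2r// mulrC ler_wpM2r ?subr_ge0//.
  by rewrite lef_pV2 ?posrE ?lerDl ?addr_gt0// ltW.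
rewrite (_ : 1 / (2 * rho) = 2 * (4 * rho)^-1); last by field; rewrite gt_eqF.
apply: (@le_trans _ _ (expR ((1 - i) / (4 * rho + i)) ^+ n.+1)).
  by rewrite lerXn2r ?nnegrE ?expR_ge0 ?expR_ge1Dx// addr_ge0.
apply: (@le_trans _ _ (expR (4 * rho)^-1 ^+ n)).
  by rewrite -!expRM_natr ler_expR.
by rewrite lerXn2r ?nnegrE ?expR_ge0 ?addr_ge0 ?mulr_ge0 ?expR_le1D2x.
Qed.

Lemma volume_large_rho n :
  (((1 + 1 / (2 * rho)) ^+ n)%:E <=
   volume n.+1 [set t : n.+1.-tuple R | in_cube t && wsums_ge0 rho t])%E.
Proof.
pose S := [set t : n.+1.-tuple R | in_cube t && wsums_ge0 rho t].
have mS : measurable S.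
  have := measurable_and (measurable_in_cube n.+1) (measurable_wsums_ge0 rho n.+1).
  by move=> /(_ measurableT [set true] Logic.I); rewrite setTI.
have [rn _] := iter_affine_step_ge n.
apply: (@le_trans _ _ (iter n.+1 affine_step (1, 0)).1%:E); first by rewrite lee_fin.
(* The payoff with coefficients (1, 0) is the indicator of the set to be measured. *)
apply: le_trans (integral_capped_affine n.+1 _ _ ler01 (lexx 0)) _.
rewrite -/S -[S]setIT -integral_indic//.
rewrite le_eqVlt; apply/orP; left; apply/eqP; apply: eq_integral => t _.
rewrite /capped_affine mul0r addr0 indicE.
by case: ifPn => ts; [rewrite mem_set | rewrite memNset//; exact/negP].
Qed.

End LargeRho.

(** * The case rho < 1: pulling back the threshold *)

Section SmallRho.
Context {R : realType} (rho : R).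
Context (rho_gt0 : 0 < rho).

Definition reaching n (c : R) : set (n.-tuple R) :=
  [set t | in_cube t && wsums_ge0 rho t && (c <= wsum rho t)].

Lemma measurable_reaching n (c : R) : measurable (reaching n c).
Proof.
have m : measurable_fun setT (fun t : n.-tuple R =>
    in_cube t && wsums_ge0 rho t && (c <= wsum rho t)).
  apply: measurable_and.
    by apply: measurable_and; [exact: measurable_in_cube|exact: measurable_wsums_ge0].
  by apply: measurable_fun_ler => //; exact: measurable_wsum.
have := m measurableT [set true].
by rewrite setTI; apply.
Qed.

(** If the tail sum is at least rho (c + |x|), the new sum is at least x + c + |x| >= c >= 0. Using
    |x| rather than -x keeps the pulled-back threshold nonnegative, as the induction requires. *)
Lemma volume_reaching_step n (c x : R) : 0 <= c -> -1 <= x <= 1 ->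
  (volume n (reaching n (rho * (c + `|x|))) <=
   volume n [set t | reaching n.+1 c (cons_pair (x, t))])%E.
Proof.
move=> c0 x1; apply: le_measure; rewrite ?inE.
- exact: measurable_reaching.
- have mc : measurable_fun setT (fun t : n.-tuple R => cons_pair (x, t)).
    exact: measurableT_comp (@measurable_cons_pair R n) (pair1_measurable x).
  by have := mc measurableT _ (measurable_reaching n.+1 c); rewrite setTI.
move=> t; rewrite /reaching /mkset => /andP[/andP[ct st]].
rewrite mulrC -ler_pdivlMr// => cw; have xx := ler_norm (- x); rewrite normrN in xx.
rewrite in_cube_cons wsums_ge0_cons wsum_cons ct st x1/= andbT.
by apply/andP; split; lra.
Qed.

(** The induction hypothesis at threshold rho (c + |x|) is integrated over x in [-1, 1]: the length
    doubles the factor, and the mean 1/2 of |x| supplies the new term of the sum. With one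
    coordinate only the length 1 - c of ]c, 1[ is available, so the power of 2 is one below the
    dimension. *)
Lemma volume_reaching n (c : R) : 0 <= c ->
  ((2 ^+ n * (1 - rho ^+ n * c - (\sum_(1 <= j < n.+1) rho ^+ j) / 2))%:E <=
   volume n.+1 (reaching n.+1 c))%E.
Proof.
have mv m d : measurable_fun setT
    (fun x : R => volume m [set t | reaching m.+1 d (cons_pair (x, t))]).
  have mA := measurable_reaching m.+1 d.
  exact: (measurable_volume_section _ _ _ mA).
elim: n c => [|n IHn] c c0.
  rewrite big_geq// mul0r subr0 !expr0 !mul1r.
  (* For c > 1 the claimed bound is negative. *)
  have [c1|c1] := leP c 1; last by apply: le_trans (measure_ge0 _ _); rewrite lee_fin; lra.
  rewrite volumeS (_ : 1 - c = 0 / 2 * (1 ^+ 2 - c ^+ 2) + 1 * (1 - c)); last by ring.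
  apply: integral_ge_affine => // x.
  rewrite in_itv/= mul0r add0r => /andP[cx x1].
  rewrite diracE mem_set// /reaching/= mul0r addr0 !andbT.
  by apply/andP; split; [apply/andP; split; [apply/andP; split|]|]; lra.
have -> : \sum_(1 <= j < n.+2) rho ^+ j = \sum_(1 <= j < n.+1) rho ^+ j + rho ^+ n.+1.
  by rewrite big_nat_recr.
rewrite volumeS; set sg := \sum_(_ <= _ < _) _.
(* [K] collects the terms free of the first coordinate x; the rest is a multiple of |x|, whence two
   affine pieces with opposite slopes meeting at 0. *)
pose K : R := 1 - rho ^+ n.+1 * c - sg / 2.
rewrite (_ : 2 ^+ n.+1 * _ =
   (2 ^+ n * rho ^+ n.+1) / 2 * (0 ^+ 2 - (-1) ^+ 2) + 2 ^+ n * K * (0 - -1) +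
   ((- (2 ^+ n * rho ^+ n.+1)) / 2 * (1 ^+ 2 - 0 ^+ 2) + 2 ^+ n * K * (1 - 0))); last first.
  by rewrite /K exprS; field.
have bound (x : R) : -1 <= x <= 1 ->
    ((2 ^+ n * (K - rho ^+ n.+1 * `|x|))%:E <=
     volume n.+1 [set t | reaching n.+2 c (cons_pair (x, t))])%E.
  move=> x1; apply: le_trans (volume_reaching_step _ _ _ c0 x1).
  have cx0 : 0 <= rho * (c + `|x|) by rewrite mulr_ge0 ?addr_ge0// ltW.
  apply: le_trans (IHn _ cx0); rewrite lee_fin -/sg /K exprSr.
  by rewrite le_eqVlt; apply/orP; left; apply/eqP; ring.
apply: integral_ge_affine2 => //.
- move=> x; rewrite in_itv/= => /andP[x1 x0].
  have xb : -1 <= x <= 1 by apply/andP; split; lra.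
  apply: le_trans (bound x xb); rewrite (ltr0_norm x0).
  by rewrite lee_fin le_eqVlt; apply/orP; left; apply/eqP; ring.
- move=> x; rewrite in_itv/= => /andP[x0 x1].
  have xb : -1 <= x <= 1 by apply/andP; split; lra.
  apply: le_trans (bound x xb); rewrite (gtr0_norm x0).
  by rewrite lee_fin le_eqVlt; apply/orP; left; apply/eqP; ring.
Qed.

End SmallRho.

Theorem proposition4 (R : realType) (M : nat) (rho : R)
    (hM : (1 <= M)%N) (hrho : 0 < rho) :
  (1 <= rho ->
    (((1 + (1 - 1 / M%:R) / (4 * rho + 1 / M%:R)) ^+ M)%:E
      <= volume M (opp_set (polar (Bcone M rho)) `&` cube M))%E) /\
  (rho < 1 ->
    ((2 ^+ (M - 1)%N * (1 - rho / (2 * (1 - rho))))%:E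
      <= volume M (opp_set (polar (Bcone M rho)) `&` cube M))%E).
Proof.
case: M hM => // n _; rewrite opp_polarE// in_cubeE.
rewrite (_ : _ `&` _ = [set t : n.+1.-tuple R | in_cube t && wsums_ge0 rho t]); last first.
  by apply/seteqP; split=> t /=; [case=> -> ->|case/andP].
split=> [rho1|rho1].
  apply: le_trans (volume_large_rho _ rho1 n); rewrite lee_fin.
  exact: large_rho_rate.
(* Threshold 0 adds no constraint, since the full sum is already nonnegative. *)
have := volume_reaching _ hrho n 0 (lexx 0).
rewrite mulr0 subr0 (_ : reaching _ _ _ = [set t : n.+1.-tuple R | in_cube t && wsums_ge0 rho t]).
  apply: le_trans; rewrite lee_fin subn1 ler_pM2l ?exprn_gt0//.
  rewrite lerD2l lerN2 invfM mulrA mulrAC ler_pM2r ?invr_gt0//.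
  rewrite ler_pdivlMr ?subr_gt0//.
  (* The finite geometric sum is at most its limit rho / (1 - rho). *)
  suff -> : (\sum_(1 <= j < n.+1) rho ^+ j) * (1 - rho) = rho - rho ^+ n.+1.
    by rewrite gerBl exprn_ge0// ltW.
  elim: n => [|n IHn]; first by rewrite big_geq// mul0r subrr.
  by rewrite big_nat_recr//= mulrDl IHn [in RHS]exprS; ring.
apply/seteqP; split=> t; rewrite /reaching /=; first by case/andP.
by move=> /andP[ct st]; rewrite ct st (wsum_ge0 _ _ st).
Qed.
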